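(* Let $n=1$ or $n=3$, let $S^{2n}\subset\mathbb{R}^{2n+1}$ be the unit sphere with the standard Euclidean metric and Levi-Civita connection $\nabla$, and let $J$ be any almost complex structure on $S^{2n}$. Let $P^\perp:S^{2n}\to\mathcal{G}_{n+1,2n+1}$ be the map induced by $J$, and let $m(X,Y)=(\nabla_{JX}J)Y-J(\nabla_XJ)Y$ be the tangent algebra. Then for all $x\in S^{2n}$ and all $X,Y\in T_xS^{2n}$, $$\overline{\partial}_XP^\perp(n_x)=0,\qquad \overline{\partial}_XP^\perp(Y+iJY)=(I-P^\perp)\big(J\,m(X,Y)\big),$$ where $n_x$ is the outward unit normal vector to $S^{2n}$ at $x$. Furthermore, $\overline{\partial}P^\perp\equiv0$ if and only if $J$ is strongly integrable with respect to $\nabla$, i.e. if and only if the tangent algebra $m$ vanishes.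
   Context: An almost complex structure on a manifold $M$ is a smooth section $J$ of $\operatorname{End}(TM)$ with $J^2=-\operatorname{Id}$. $(\nabla_X J)Y=\nabla_X(JY)-J\nabla_XY$. $J$ is strongly integrable with respect to $\nabla$ if $\nabla_{JX}J=J\nabla_XJ$ for all $X$. $T^{0,1}_x=\{v\in T_xM\otimes\mathbb{C}: Jv=-iv\}$. $\mathcal{G}_{k,N}=\{P\in M_{N\times N}(\mathbb{C}):P^2=P,\ P^*=P,\ \operatorname{rank}P=k\}$ (orthogonal projections of rank $k$ on $\mathbb{C}^N$ with the standard inner product), a model of the complex Grassmannian. Tangent vectors at $P$ are self-adjoint matrices $A$ with $AP=(I-P)A$ and $PA=A(I-P)$, i.e. in the splitting $\mathbb{C}^N=\operatorname{Im}P\oplus\operatorname{Ker}P$ they have the form $\begin{bmatrix} 0 & B \\ B^* & 0 \end{bmatrix}$ with $B:\operatorname{Ker}P\to\operatorname{Im}P$. The complex structure $K$ on $T_P\mathcal{G}_{k,N}$ is $K\begin{bmatrix} 0 & B \\ B^* & 0 \end{bmatrix}=\begin{bmatrix} 0 & -iB \\ iB^* & 0 \end{bmatrix}$, i.e. multiplication by $+i$ on the $\operatorname{Hom}(\operatorname{Im}P,\operatorname{Ker}P)$ component and by $-i$ on the $\operatorname{Hom}(\operatorname{Ker}P,\operatorname{Im}P)$ component. The map $P^\perp$ sends $x$ to the orthogonal projection of $\mathbb{C}^{2n+1}$ onto $T^{0,1}_x\oplus(N_x\otimes\mathbb{C})$, where $N_x$ is the Euclidean normal line at $x$. For a map $f:(M,J)\to(N,K)$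 of almost complex manifolds, $\overline{\partial}_Xf=d_{JX}f-K\circ d_Xf$. In the formulas, $\overline{\partial}_XP^\perp\in T_{P^\perp(x)}\mathcal{G}_{n+1,2n+1}$ is a matrix, which is applied to vectors of $\mathbb{C}^{2n+1}$. *)

(* Defs.v *)
From HB Require Import structures.
From mathcomp Require Import all_boot all_order all_algebra.
From mathcomp Require Export sesquilinear spectral.
From mathcomp Require Export complex.
From mathcomp Require Import all_classical all_reals all_analysis.
Set Implicit Arguments.
Unset Strict Implicit.
Unset Printing Implicit Defensive.
Import Order.TTheory GRing.Theory Num.Theory.
Import numFieldNormedType.Exports.
Local Open Scope classical_set_scope.
Local Open Scope ring_scope.
Local Open Scope sesquilinear_scope.
Local Open Scope complex_scope.

(* Vectors are row vectors throughout: a matrix A acts by v |-> v *m A. *)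

Section Sphere.
Context {R : realType} {d : nat}.
Local Notation E := 'rV[R]_d.

Definition dotv (u v : E) : R := (u *m v^T) 0 0.

Definition sphere : set E := [set x | dotv x x = 1].

Definition tangent (x : E) : set E := [set v | dotv x v = 0].

Definition outward_normal (x : E) : E := x.

(* Maps on the sphere are represented by functions on the ambient space E; only
   their values on the sphere are meaningful. *)

Fixpoint Ck_on (W : normedModType R) (k : nat) (U : set E) (f : E -> W) : Prop :=
  match k with
  | 0 => forall x, U x -> {for x, continuous f}
  | k'.+1 => (forall x, U x -> differentiable f x) /\
             forall v, Ck_on k' U (fun x => 'D_v f x)
  end.

Definition smooth_sphere (W : normedModType R) (f : E -> W) : Prop :=
  forall x, sphere x -> exists (U : set E) (g : E -> W),
    [/\ open U, U x, forall k, Ck_on k U g &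
        forall y, U y -> sphere y -> f y = g y].

Definition radial (y : E) : E := (Num.sqrt (dotv y y))^-1 *: y.

(* d_X f at x, for X tangent to the sphere at x: f \o radial extends f from
   the sphere to a neighbourhood of x, and any differentiable extension has the
   same derivative along X. *)
Definition dsphere (W : normedModType R) (f : E -> W) (x X : E) : W :=
  'D_X (f \o radial) x.

Definition vfield (V : E -> E) : Prop :=
  smooth_sphere V /\ forall x, sphere x -> tangent x (V x).

Definition dfield (W : normedModType R) (V : E -> E) (f : E -> W) : E -> W :=
  fun x => dsphere f x (V x).

Record affine_connection (nabla : (E -> E) -> (E -> E) -> E -> E) : Prop := {
  conn_vfield : forall V W, vfield V -> vfield W -> vfield (nabla V W) ;
  conn_addl : forall V V' W, vfield V -> vfield V' -> vfield W ->
    forall x, sphere x ->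
    nabla (fun y => V y + V' y) W x = nabla V W x + nabla V' W x ;
  conn_scalel : forall (f : E -> R) V W, smooth_sphere f -> vfield V -> vfield W ->
    forall x, sphere x ->
    nabla (fun y => f y *: V y) W x = f x *: nabla V W x ;
  conn_addr : forall V W W', vfield V -> vfield W -> vfield W' ->
    forall x, sphere x ->
    nabla V (fun y => W y + W' y) x = nabla V W x + nabla V W' x ;
  conn_leibniz : forall (f : E -> R) V W, smooth_sphere f -> vfield V -> vfield W ->
    forall x, sphere x ->
    nabla V (fun y => f y *: W y) x = f x *: nabla V W x + dfield V f x *: W x
}.

(* Torsion-freeness nabla_V W - nabla_W V = [V, W] is expressed by the action of
   both sides as derivations on functions. *)
Record levi_civita (nabla : (E -> E) -> (E -> E) -> E -> E) : Prop := {
  lc_connection : affine_connection nabla ;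
  lc_metric : forall V W Z, vfield V -> vfield W -> vfield Z ->
    forall x, sphere x ->
    dfield V (fun y => dotv (W y) (Z y)) x =
      dotv (nabla V W x) (Z x) + dotv (W x) (nabla V Z x) ;
  lc_torsion_free : forall V W (f : E -> R), vfield V -> vfield W ->
    smooth_sphere f -> forall x, sphere x ->
    dfield (fun y => nabla V W y - nabla W V y) f x =
      dfield V (dfield W f) x - dfield W (dfield V f) x
}.

(* A section of End(TS) is a matrix-valued map preserving the tangent spaces;
   J x is irrelevant on the normal line. *)
Record almost_complex (J : E -> 'M[R]_d) : Prop := {
  acs_smooth : smooth_sphere J ;
  acs_tangent : forall x v, sphere x -> tangent x v -> tangent x (v *m J x) ;
  acs_square : forall x v, sphere x -> tangent x v -> v *m J x *m J x = - v
}.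

Definition actJ (J : E -> 'M[R]_d) (V : E -> E) : E -> E := fun x => V x *m J x.

(* (nabla_V J) W *)
Definition covJ nabla (J : E -> 'M[R]_d) (V W : E -> E) : E -> E :=
  fun x => nabla V (actJ J W) x - nabla V W x *m J x.

Definition strongly_integrable nabla (J : E -> 'M[R]_d) : Prop :=
  forall V W, vfield V -> vfield W -> forall x, sphere x ->
    covJ nabla J (actJ J V) W x = covJ nabla J V W x *m J x.

Definition tangent_algebra nabla (J : E -> 'M[R]_d) (V W : E -> E) : E -> E :=
  fun x => covJ nabla J (actJ J V) W x - covJ nabla J V W x *m J x.

End Sphere.

Arguments sphere {R d}.

Section Grassmannian.
Context {R : realType} {N : nat}.
Local Notation C := R[i].

Definition grassmannian (k : nat) : set 'M[C]_N :=
  [set P | [/\ P *m P = P, P ^t* = P & \rank P = k]].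

Definition grass_tangent (P : 'M[C]_N) : set 'M[C]_N :=
  [set A | [/\ A ^t* = A, A *m P = (1%:M - P) *m A & P *m A = A *m (1%:M - P)]].

(* Matrices act on the right, so P *m A *m (1%:M - P) is the Hom(Im P, Ker P)
   component of A and (1%:M - P) *m A *m P its Hom(Ker P, Im P) component. *)
Definition grassK (P A : 'M[C]_N) : 'M[C]_N :=
  'i%C *: (P *m A *m (1%:M - P)) - 'i%C *: ((1%:M - P) *m A *m P).

Lemma grassKE P A : P *m P = P -> grass_tangent P A ->
  P *m A *m P = 0 /\ grassK P A = 'i%C *: (P *m A - A *m P).
Proof.
move=> PP [_ _ PA].
have PAP : P *m A *m P = 0.
  by rewrite PA -mulmxA mulmxBl mul1mx PP subrr mulmx0.
split=> //; rewrite /grassK mulmxBr mulmx1 PAP subr0 !mulmxBl mul1mx PAP subr0.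
by rewrite scalerBr.
Qed.

Lemma grassK_tangent P A : P *m P = P -> P ^t* = P ->
  grass_tangent P A -> grass_tangent P (grassK P A).
Proof.
move=> PP Ph tA; have [PAP ->] := grassKE PP tA; case: tA => Ah _ _.
have trM (B D : 'M[C]_N) : (B *m D) ^t* = D ^t* *m B ^t*.
  by rewrite trmx_mul map_mxM.
split.
- rewrite linearZ /= map_mxZ linearB /= map_mxB !trM Ah Ph.
  have -> : Num.conj ('i%C : C) = - 'i%C by apply/eqP; rewrite eq_complex /= oppr0 !eqxx.
  by rewrite scaleNr -scalerN opprB.
- rewrite -scalemxAl -scalemxAr; congr (_ *: _).
  rewrite mulmxBl PAP -mulmxA PP mulmxBl mul1mx mulmxBr !mulmxA PP PAP.
  by rewrite subr0 sub0r addrAC subrr sub0r.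
- rewrite -scalemxAl -scalemxAr; congr (_ *: _).
  rewrite mulmxBr !mulmxA PP PAP mulmxBr mulmx1 mulmxBl PAP -[A *m P *m P]mulmxA PP.
  by rewrite subr0 sub0r opprK subrK.
Qed.

Lemma grassK_square P A : P *m P = P -> P ^t* = P -> grass_tangent P A ->
  grassK P (grassK P A) = - A.
Proof.
move=> PP Ph tA; have tK := grassK_tangent PP Ph tA.
have [_ ->] := grassKE PP tK; have [PAP ->] := grassKE PP tA.
case: tA => _ _ PA; rewrite -scalemxAl -scalemxAr -scalerBr scalerA.
have -> : 'i%C * 'i%C = -1 :> C by rewrite -expr2 sqr_i.
rewrite scaleN1r mulmxBr mulmxBl !mulmxA PP PAP -[A *m P *m P]mulmxA PP.
by rewrite subr0 sub0r opprK PA mulmxBr mulmx1 subrK.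
Qed.

End Grassmannian.

Section InducedMap.
Context {R : realType} {d : nat}.
Local Notation E := 'rV[R]_d.
Local Notation C := R[i].

Definition toC (m n : nat) (A : 'M[R]_(m, n)) : 'M[C]_(m, n) :=
  map_mx (real_complex R) A.

(* T^{0,1}_x: the vectors v of T_x (x) C with J v = - i v *)
Definition T01 (J : E -> 'M[R]_d) (x : E) : 'M[C]_d :=
  (kermx (toC x)^T :&: eigenspace (toC (J x)) (- 'i%C))%MS.

Definition Pperp (J : E -> 'M[R]_d) (x : E) : 'M[C]_d :=
  proj_ortho (T01 J x + toC x)%MS.

Definition dsphereC (m n : nat) (f : E -> 'M[C]_(m, n)) (x X : E) : 'M[C]_(m, n) :=
  toC (dsphere (fun y => map_mx (@complex.Re R) (f y)) x X) +
  'i%C *: toC (dsphere (fun y => map_mx (@complex.Im R) (f y)) x X).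

Definition dbar (J : E -> 'M[R]_d) (f : E -> 'M[C]_d) (x X : E) : 'M[C]_d :=
  dsphereC f x (X *m J x) - grassK (f x) (dsphereC f x X).

End InducedMap.

Lemma proj_ortho_grassmannian (R : realType) (N m : nat) (U : 'M[R[i]]_(m, N)) :
  grassmannian (\rank U) (proj_ortho U).
Proof.
set P := proj_ortho U.
have PP : P *m P = P by exact: proj_ortho_proj.
have PQ : P *m ((1%:M - P) ^t*) = 0.
  apply/orthomx1P; apply: (submx_trans (_ : (P <= U)%MS)).
    by rewrite proj_orthoE.
  rewrite orthomx_sym.
  by have := proj_ortho_compl_sub U (1%:M : 'M[R[i]]_N); rewrite mul1mx.
have PE : P = P *m P ^t*.
  apply/eqP; rewrite -subr_eq0; apply/eqP; rewrite -[RHS]PQ.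
  by rewrite linearB /= map_mxB trmx1 map_mx1 mulmxBr mulmx1.
split=> //.
- by rewrite {1}PE trmx_mul map_mxM trmxCK -PE.
- by rewrite proj_orthoE.
Qed.

Lemma rank_cap_eigenspace (K : numFieldType) (cj : {rmorphism K -> K}) (N : nat)
    (T G : 'M[K]_N) (i : K) : i * i = -1 -> cj i = - i ->
  map_mx cj T = T -> map_mx cj G = G -> (T *m G <= T)%MS -> T *m G *m G = - T ->
  \rank T = (2 * \rank (T :&: eigenspace G (- i))%MS)%N.
Proof.
move=> ii cji cjT cjG TG TGG.
have i0 : i != 0 by apply: contra_eqN ii => /eqP ->; rewrite mul0r eq_sym oppr_eq0 oner_eq0.
have rF : \rank (T :&: eigenspace G i)%MS = \rank (T :&: eigenspace G (- i))%MS.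
  rewrite -(mxrank_map cj (T :&: eigenspace G i)%MS) map_capmx.
  by rewrite (map_eigenspace cj) cjT cjG cji.
have dir : ((T :&: eigenspace G i) :&: (T :&: eigenspace G (- i)) = 0)%MS.
  apply/eqP/rowV0Pn => -[v]; rewrite !sub_capmx => /andP[/andP[_ /eigenspaceP v1]].
  case/andP => _ /eigenspaceP; rewrite v1 scaleNr => /eqP.
  rewrite -addr_eq0 -scalerDl scaler_eq0 -mulr2n mulrn_eq0 /= (negPf i0) /=.
  by move=> /eqP ->; rewrite eqxx.
have sumF : ((T :&: eigenspace G i) + (T :&: eigenspace G (- i)) :=: T)%MS.
  apply/eqmxP; rewrite addsmx_sub !capmxSl /=.
  have h (a : K) : a * a = -1 -> ((T + a^-1 *: (T *m G))%R <= T :&: eigenspace G a)%MS.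
    move=> aa; have a0 : a != 0.
      by apply: contra_eqN aa => /eqP ->; rewrite mul0r eq_sym oppr_eq0 oner_eq0.
    rewrite sub_capmx addmx_sub ?scalemx_sub //=.
    apply/eigenspaceP; rewrite mulmxDl -scalemxAl TGG scalerDr scalerA divff //.
    rewrite scale1r addrC; congr (_ + _); rewrite scalerN -scaleNr; congr (_ *: _).
    by apply: (mulfI a0); rewrite aa mulrN divff.
  have TE : T = 2^-1 *: ((T + i^-1 *: (T *m G)) + (T + (- i)^-1 *: (T *m G))).
    rewrite addrACA invrN scaleNr subrr addr0 -mulr2n -(scaler_nat 2 T) scalerA.
    by rewrite mulVf ?scale1r // pnatr_eq0.
  by rewrite {1}TE scalemx_sub // addmx_sub_adds // h // mulrNN.
have := mxrank_sum_cap (T :&: eigenspace G i)%MS (T :&: eigenspace G (- i))%MS.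
by rewrite dir mxrank0 addn0 sumF rF addnn mul2n.
Qed.

Lemma rank_T01 (R : realType) (n : nat)
    (J : 'rV[R]_(2 * n + 1) -> 'M[R]_(2 * n + 1)) x :
  almost_complex J -> sphere x -> \rank (T01 J x) = n.
Proof.
move=> acJ Sx.
have TE : kermx (toC x)^T = toC (kermx x^T) by rewrite /toC map_kermx map_trmx.
have rT : \rank (kermx (toC x)^T) = (2 * n)%N.
  rewrite TE mxrank_map mxrank_ker mxrank_tr.
  suff -> : \rank x = 1%N by rewrite addnK.
  rewrite rank_rV; case: eqP => // x0; move: Sx.
  by rewrite /sphere /= /dotv x0 mul0mx mxE => /eqP; rewrite eq_sym oner_eq0.
have tK i : tangent x (row i (kermx x^T)).
  rewrite /tangent /= /dotv; suff -> : x *m (row i (kermx x^T))^T = 0 by rewrite mxE.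
  by apply: trmx_inj; rewrite trmx_mul trmxK -row_mul mulmx_ker row0 trmx0.
suff h : \rank (kermx (toC x)^T) = (2 * \rank (T01 J x))%N.
  by apply/eqP; rewrite -(eqn_pmul2l (isT : 0 < 2)%N) -h rT.
have cjR p q (A : 'M[R]_(p, q)) : map_mx (@Num.conj R[i]) (toC A) = toC A.
  by apply/matrixP => a b; rewrite !mxE; apply/eqP; rewrite eq_complex /= oppr0 !eqxx.
apply: (rank_cap_eigenspace (cj := @Num.conj R[i])).
- by rewrite -expr2 sqr_i.
- by apply/eqP; rewrite eq_complex /= oppr0 !eqxx.
- by rewrite TE cjR.
- by rewrite cjR.
- rewrite TE /toC -map_mxM map_submx; apply/row_subP => i; rewrite row_mul.
  apply/sub_kermxP; have := acs_tangent acJ Sx (tK i); rewrite /tangent /= /dotv => h.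
  rewrite -[LHS]trmxK trmx_mul trmxK.
  by apply/matrixP => a b; rewrite !ord1 mxE h mxE.
- rewrite TE /toC -!map_mxM -map_mxN; congr map_mx; apply/row_matrixP => i.
  rewrite 2!row_mul (acs_square acJ Sx (tK i)).
  by move: (kermx _) => K; apply/rowP => j; rewrite !mxE.
Qed.

Lemma Pperp_grassmannian (R : realType) (n : nat)
    (J : 'rV[R]_(2 * n + 1) -> 'M[R]_(2 * n + 1)) x :
  almost_complex J -> sphere x -> grassmannian (n + 1) (Pperp J x).
Proof.
move=> acJ Sx; suff <- : \rank (T01 J x + toC x)%MS = (n + 1)%N.
  exact: proj_ortho_grassmannian.
have Nx : toC x *m (toC x)^T = 1%:M.
  rewrite /toC map_trmx -map_mxM; apply/matrixP => a b; rewrite !ord1.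
  by rewrite mxE (_ : _ 0 0 = 1) // !mxE.
have dir : (T01 J x :&: toC x = 0)%MS.
  apply/eqP/rowV0Pn => -[v]; rewrite !sub_capmx => /andP[/andP[/sub_kermxP vx _]].
  by case/sub_rVP => a va; move: vx; rewrite va -scalemxAl Nx scalemx1 => /matrixP /(_ 0 0);
     rewrite !mxE eqxx mulr1n => ->; rewrite scale0r eqxx.
have := mxrank_sum_cap (T01 J x) (toC x); rewrite dir mxrank0 addn0 => ->.
rewrite (rank_T01 acJ Sx) rank_rV; case: eqP => // x0.
move: Nx; rewrite x0 mul0mx => /matrixP/(_ 0 0)/eqP.
by rewrite !mxE eqxx eq_sym oner_eq0.
Qed.

(* Main.v *)
Require Import Defs.
From mathcomp Require Import all_boot all_order all_algebra.
From mathcomp Require Import complex.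
From mathcomp Require Import all_classical all_reals all_analysis.
Set Implicit Arguments.
Unset Strict Implicit.
Unset Printing Implicit Defensive.
Import Order.TTheory GRing.Theory Num.Theory.
Import numFieldNormedType.Exports.
Local Open Scope classical_set_scope.
Local Open Scope ring_scope.
Local Open Scope sesquilinear_scope.
Local Open Scope complex_scope.

(** The formulas come from differentiating identities satisfied by the
    orthogonal projection P onto T01 + N. A map F on the sphere with values in
    T01 + N satisfies F P = F, so F dP_X = (d_X F)(1 - P) (dPperp_fixed), and
    since P^2 = P and P^* = P the derivative dP_X is tangent to the
    Grassmannian, where K acts on the range of P as multiplication by i. Hence
    F dbar_X P = F dP_{JX} - i F dP_X.

    For F(y) = y this equals (JX - iX)(1 - P), which vanishes because JX - iX
    lies in T01. For F = W + iJW, with W a vector field, d_X F may be computed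
    with the Levi-Civita connection, as the normal component is killed by
    1 - P; moreover nabla_X W + iJ nabla_X W lies in T01, so
    F dP_X = i (nabla_X J)W (1 - P). Modulo T01 the operator J is
    multiplication by i on real tangent vectors, and the two terms combine into
    (J m)(1 - P).

    The vectors x and Y + iJY span the range of P, and a matrix tangent to the
    Grassmannian at P that vanishes on the range of P is zero (being
    self-adjoint and exchanging range and kernel); so m = 0 implies
    dbar P = 0. Conversely T01 + N contains no nonzero real tangent vector
    (Pperp_real_tangent), so dbar P = 0 forces J m = 0.

    Three facts make this rigorous. The axioms of a Levi-Civita connection
    determine it as the tangential part of the Euclidean derivative
    (levi_civita_dsphere). Products of smooth maps are smooth, so JW is an
    admissible vector field. And P is differentiable, although it is defined
    through kernels and eigenspaces: with Q the oblique projection onto T01 + N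
    along T10, which is polynomial in y and J, one has (Q + Q^* - 1) P = Q with
    Q + Q^* - 1 invertible (orthogonal_projection_formula), so Cramer's rule
    expresses the entries of P as rational functions of those of Q and Q^*. *)

(** * Derivatives of matrix-valued maps *)

Section MatrixCalculus.
Context {R : realType} {V : normedModType R}.
Implicit Types (x v : V).

(** Decomposing along the matrix units reduces the claim to scalar functions
    times constant matrices. *)
Lemma differentiable_mx m n (F : V -> 'M[R]_(m, n)) x :
  (forall i j, differentiable (fun y => F y i j) x) -> differentiable F x.
Proof.
move=> dF.
have -> : F = \sum_(i < m) \sum_(j < n) (fun y => F y i j *: delta_mx i j).
  apply/funext => y; rewrite [LHS]matrix_sum_delta.
  rewrite fct_sumE; apply: eq_bigr => i _.
  by rewrite fct_sumE.
apply: differentiable_sum => i; apply: differentiable_sum => j.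
exact: differentiableZl.
Qed.

Lemma differentiable_entry m n (F : V -> 'M[R]_(m, n)) x i j :
  differentiable F x -> differentiable (fun y => F y i j) x.
Proof.
move=> dF; apply: (@differentiable_comp _ _ _ _ F (fun M => M i j)) => //.
exact: differentiable_coord.
Qed.

Lemma is_derive_mxP m n (F : V -> 'M[R]_(m, n)) x v A :
  is_derive x v F A <-> forall i j, is_derive x v (fun y => F y i j) (A i j).
Proof.
split=> [[dF <-] i j|dF].
  split; first by move/derivable_mxP : dF; apply.
  by rewrite derive_mx// mxE.
have dF' : derivable F x v.
  by apply/derivable_mxP => i j; have [] := dF i j.
split=> //; rewrite derive_mx//; apply/matrixP => i j; rewrite mxE.
by have [] := dF i j.
Qed.

Lemma is_derive_sumf (I : Type) (r : seq I) (W : normedModType R)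
    (f : I -> V -> W) (df : I -> W) x v :
  (forall i, is_derive x v (f i) (df i)) ->
  is_derive x v (fun y => \sum_(i <- r) f i y) (\sum_(i <- r) df i).
Proof.
move=> fd; elim: r => [|i r IH].
  rewrite big_nil (_ : (fun _ => _) = cst 0); first exact: is_derive_cst.
  by apply/funext => y; rewrite big_nil.
rewrite big_cons (_ : (fun _ => _) = f i + (fun y => \sum_(i <- r) f i y)).
  exact: is_deriveD.
by apply/funext => y; rewrite big_cons.
Qed.

Lemma is_derive_mulr (f g : V -> R) x v (df dg : R) :
  is_derive x v f df -> is_derive x v g dg ->
  is_derive x v (fun y => f y * g y) (df * g x + f x * dg).
Proof.
move=> fd gd; apply: (is_derive_eq (is_deriveM fd gd)).
by rewrite addrC [_ *: _]mulrC.
Qed.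

Lemma is_derive_mulmx m n p (F : V -> 'M[R]_(m, n)) (G : V -> 'M[R]_(n, p))
    x v A B : is_derive x v F A -> is_derive x v G B ->
  is_derive x v (fun y => F y *m G y) (A *m G x + F x *m B).
Proof.
move=> /is_derive_mxP FA /is_derive_mxP GB; apply/is_derive_mxP => i k.
rewrite (_ : (fun _ => _) = fun y => \sum_j F y i j * G y j k); last first.
  by apply/funext => y; rewrite mxE.
rewrite !mxE -big_split/=; apply: is_derive_sumf => j.
exact: is_derive_mulr.
Qed.

Lemma is_derive_trmx m n (F : V -> 'M[R]_(m, n)) x v A :
  is_derive x v F A -> is_derive x v (fun y => (F y)^T) A^T.
Proof.
move=> /is_derive_mxP FA; apply/is_derive_mxP => i j.
rewrite (_ : (fun _ => _) = fun y => F y j i) ?mxE//.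
by apply/funext => y; rewrite mxE.
Qed.

End MatrixCalculus.

Lemma near_eq_differentiable {R : realType} {V W : normedModType R} (f g : V -> W) x :
  {near x, f =1 g} -> differentiable f x -> differentiable g x.
Proof.
move=> fg df; have fgx : f x = g x := nbhs_singleton fg.
have dfc : continuous ('d f x) by exact: diff_continuous.
have gE : g \o shift x = cst (g x) + 'd f x +o_ 0 id.
  apply/eqaddoP => e e0.
  have /eqaddoP /(_ e e0) := diff_locally df.
  have : \forall h \near (0 : V), f (h + x) = g (h + x).
    by have := fg; rewrite (near_shift 0) subr0.
  apply: filterS2 => h /= fgh.
  by rewrite !fctE /= fgh fgx.
by apply/diff_locallyP; rewrite (diff_unique dfc gE).
Qed.

(** * Smooth maps on the sphere *)

Section CkOn.
Context {R : realType} {d : nat}.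
Local Notation E := 'rV[R]_d.
Implicit Types (U : set E).

(** Openness lets identities between derivatives that hold only on U, such as
    the product rule, be used inside the recursive definition of Ck_on. *)
Lemma eq_Ck_on (W : normedModType R) k U (f g : E -> W) : open U ->
  (forall x, U x -> f x = g x) -> Ck_on k U f -> Ck_on k U g.
Proof.
move=> oU; elim: k f g => [|k IH] f g fg /=; have nfg x : U x -> {near x, f =1 g}.
- by move=> Ux; apply: filterS (open_nbhs_nbhs (conj oU Ux)) => y /fg.
- move=> fc x Ux; have := fc x Ux; rewrite /prop_for /continuous_at -(fg x Ux).
  by apply: cvg_trans; exact: near_eq_cvg (nfg x Ux).
- by move=> Ux; apply: filterS (open_nbhs_nbhs (conj oU Ux)) => y /fg.
move=> [df dDf]; split.
  by move=> x Ux; apply: near_eq_differentiable (nfg x Ux) (df x Ux).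
move=> v; apply: (IH _ _ _ (dDf v)) => x Ux.
exact: near_eq_derive (nfg x Ux).
Unshelve. all: by end_near. Qed.

Lemma Ck_on_subset (W : normedModType R) k U U' (f : E -> W) : U' `<=` U ->
  Ck_on k U f -> Ck_on k U' f.
Proof.
move=> UU'; elim: k f => [|k IH] f /=.
  by move=> fc x /UU'; exact: fc.
by move=> [df dDf]; split=> [x /UU'|v]; [exact: df|exact: IH].
Qed.

Lemma Ck_onW (W : normedModType R) k U (f : E -> W) :
  Ck_on k.+1 U f -> Ck_on k U f.
Proof.
elim: k f => [|k IH] f /= [df dDf].
  by move=> x /df; exact: differentiable_continuous.
by split=> // v; apply: IH; exact: dDf.
Qed.

Lemma Ck_on_cst (W : normedModType R) k U (w : W) : Ck_on k U (fun=> w).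
Proof.
elim: k w => [|k IH] w /=; first by move=> x _; exact: cst_continuous.
split=> [x _|v]; first exact: differentiable_cst.
rewrite (_ : (fun x => _) = (fun=> 0 : W)); first exact: IH.
by apply/funext => x; exact: derive_cst.
Qed.

Lemma Ck_on_coord k U j : Ck_on k U (fun y : E => y 0 j).
Proof.
case: k => [|k] /=; first by move=> x _; exact: coord_continuous.
split=> [x _|v]; first exact: differentiable_coord.
rewrite (_ : (fun _ => _) = fun=> v 0 j); first exact: Ck_on_cst.
apply/funext => x; apply: derive_val.
by have /is_derive_mxP := is_derive_id x v; apply.
Qed.

Lemma Ck_onD (W : normedModType R) k U (f g : E -> W) : open U ->
  Ck_on k U f -> Ck_on k U g -> Ck_on k U (fun x => f x + g x).
Proof.
move=> oU; elim: k f g => [|k IH] f g /=.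
  by move=> fc gc x Ux; exact: (continuousD (fc x Ux) (gc x Ux)).
move=> [df dDf] [dg dDg]; split=> [x Ux|v].
  by apply: differentiableD; [exact: df|exact: dg].
apply: (eq_Ck_on oU) (IH _ _ (dDf v) (dDg v)) => x Ux.
by rewrite deriveD//; apply: diff_derivable; [exact: df|exact: dg].
Qed.

Lemma Ck_onM k U (f g : E -> R) : open U ->
  Ck_on k U f -> Ck_on k U g -> Ck_on k U (fun x => f x * g x).
Proof.
move=> oU; elim: k f g => [|k IH] f g.
  by move=> fc gc x Ux; exact: (continuousM (fc x Ux) (gc x Ux)).
move=> fC gC; have fC' := Ck_onW fC; have gC' := Ck_onW gC.
move: fC gC => [df dDf] [dg dDg]; split=> [x Ux|v].
  by apply: differentiableM; [exact: df|exact: dg].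
apply: (eq_Ck_on oU) (Ck_onD oU (IH _ _ (dDf v) gC') (IH _ _ fC' (dDg v))) => x Ux.
symmetry; apply: derive_val.
by apply: is_derive_mulr; apply/derivableP/diff_derivable; [exact: df|exact: dg].
Qed.

Lemma Ck_on_mxP m n k U (F : E -> 'M[R]_(m, n)) : open U ->
  Ck_on k U F <-> forall i j, Ck_on k U (fun x => F x i j).
Proof.
move=> oU; elim: k F => [|k IH] F /=; split.
- move=> cF i j x Ux; apply: (@continuous_comp _ _ _ F (fun M => M i j)).
    exact: cF.
  exact: coord_continuous.
- move=> cF x Ux; apply/(@cvgrPdist_le _ _ _ (nbhs x)) => /= e e0.
  have : \forall y \near x, forall ij : 'I_m * 'I_n,
      `|F x ij.1 ij.2 - F y ij.1 ij.2| <= e.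
    apply: (@filter_forall _ _ _ (nbhs x)) => ij.
    by have /(@cvgrPdist_le _ _ _ (nbhs x)) := cF ij.1 ij.2 x Ux; apply.
  apply: filterS => y Fxy.
  rewrite /Num.Def.normr/= mx_normrE (bigmax_le _ (ltW e0))//= => ij _.
  by rewrite !mxE/=.
- move=> [dF dDF] i j; split=> [x Ux|v]; first exact/differentiable_entry/dF.
  apply: (eq_Ck_on oU) ((IH _).1 (dDF v) i j) => x Ux.
  by rewrite derive_mx ?mxE//; apply/diff_derivable/dF.
- move=> CF; split=> [x Ux|v].
    by apply: differentiable_mx => i j; have [+ _] := CF i j; apply.
  apply/IH => i j; have [_ /(_ v)] := CF i j.
  apply: (eq_Ck_on oU) => x Ux; rewrite derive_mx ?mxE//.
  by apply/derivable_mxP => k' l; have [+ _] := CF k' l; move=> /(_ x Ux)/diff_derivable; apply.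
Unshelve. all: by end_near. Qed.

Lemma Ck_on_sum (I : Type) (r : seq I) (W : normedModType R) k U (f : I -> E -> W) :
  open U -> (forall i, Ck_on k U (f i)) ->
  Ck_on k U (fun x => \sum_(i <- r) f i x).
Proof.
move=> oU fC; elim: r => [|i r IH].
  rewrite (_ : (fun _ => _) = fun=> 0); first exact: Ck_on_cst.
  by apply/funext => y; rewrite big_nil.
rewrite (_ : (fun _ => _) = fun y => f i y + \sum_(i <- r) f i y).
  exact: Ck_onD.
by apply/funext => y; rewrite big_cons.
Qed.

Lemma Ck_on_mulmx m n p k U (F : E -> 'M[R]_(m, n)) (G : E -> 'M[R]_(n, p)) :
  open U -> Ck_on k U F -> Ck_on k U G -> Ck_on k U (fun x => F x *m G x).
Proof.
move=> oU /Ck_on_mxP FC /Ck_on_mxP GC; apply/Ck_on_mxP => // i l.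
rewrite (_ : (fun _ => _) = fun y => \sum_j F y i j * G y j l); last first.
  by apply/funext => y; rewrite mxE.
by apply: Ck_on_sum => // j; apply: Ck_onM => //; [exact: FC|exact: GC].
Qed.

Lemma smooth_sphereD (W : normedModType R) (f g : E -> W) :
  smooth_sphere f -> smooth_sphere g -> smooth_sphere (fun x => f x + g x).
Proof.
move=> fS gS x Sx; have [U [f' [oU Ux fC ff']]] := fS x Sx.
have [U' [g' [oU' Ux' gC gg']]] := gS x Sx.
exists (U `&` U'), (fun y => f' y + g' y).
have oUU : open (U `&` U') by exact: openI.
split=> // [k|y [Uy Uy'] Sy]; last by rewrite ff' ?gg'.
apply: Ck_onD => //; first by apply: Ck_on_subset (fC k) => y [].
by apply: Ck_on_subset (gC k) => y [].
Qed.

Lemma smooth_sphere_mulmx m n p (F : E -> 'M[R]_(m, n)) (G : E -> 'M[R]_(n, p)) :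
  smooth_sphere F -> smooth_sphere G -> smooth_sphere (fun x => F x *m G x).
Proof.
move=> fS gS x Sx; have [U [f' [oU Ux fC ff']]] := fS x Sx.
have [U' [g' [oU' Ux' gC gg']]] := gS x Sx.
exists (U `&` U'), (fun y => f' y *m g' y).
have oUU : open (U `&` U') by exact: openI.
split=> // [k|y [Uy Uy'] Sy]; last by rewrite ff' ?gg'.
apply: Ck_on_mulmx => //; first by apply: Ck_on_subset (fC k) => y [].
by apply: Ck_on_subset (gC k) => y [].
Qed.

Lemma smooth_sphere_ambient (W : normedModType R) (f : E -> W) :
  (forall k, Ck_on k setT f) -> smooth_sphere f.
Proof. by move=> fC x _; exists setT, f; split=> //; exact: openT. Qed.

Lemma smooth_sphere_coord j : smooth_sphere (fun y : E => y 0 j).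
Proof. by apply: smooth_sphere_ambient => k; exact: Ck_on_coord. Qed.

Lemma smooth_sphere_cst (W : normedModType R) (w : W) :
  smooth_sphere (fun _ : E => w).
Proof. by apply: smooth_sphere_ambient => k; exact: Ck_on_cst. Qed.

Lemma smooth_sphere_id : smooth_sphere (id : E -> E).
Proof.
apply: smooth_sphere_ambient => k; apply/(Ck_on_mxP _ _ openT) => i j.
by rewrite ord1; exact: Ck_on_coord.
Qed.

End CkOn.
(** * Radial extension and directional derivatives *)

Section SphereCalculus.
Context {R : realType} {d : nat}.
Local Notation E := 'rV[R]_d.
Implicit Types (x y v X : E).

Lemma dotvE x y : dotv x y = \sum_j x 0 j * y 0 j.
Proof. by rewrite /dotv mxE; apply: eq_bigr => j _; rewrite mxE. Qed.

Lemma dotvC x y : dotv x y = dotv y x.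
Proof. by rewrite !dotvE; apply: eq_bigr => j _; rewrite mulrC. Qed.

Lemma dotvDl x y v : dotv (x + y) v = dotv x v + dotv y v.
Proof. by rewrite /dotv mulmxDl mxE. Qed.

Lemma dotvDr x y v : dotv v (x + y) = dotv v x + dotv v y.
Proof. by rewrite dotvC dotvDl ![dotv v _]dotvC. Qed.

Lemma dotvZl a x y : dotv (a *: x) y = a * dotv x y.
Proof. by rewrite /dotv -scalemxAl mxE. Qed.

Lemma dotvZr a x y : dotv x (a *: y) = a * dotv x y.
Proof. by rewrite dotvC dotvZl dotvC. Qed.

Lemma dotvBl x y v : dotv (x - y) v = dotv x v - dotv y v.
Proof. by rewrite -scaleN1r dotvDl dotvZl mulN1r. Qed.

Lemma dotvBr x y v : dotv v (x - y) = dotv v x - dotv v y.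
Proof. by rewrite dotvC dotvBl ![dotv v _]dotvC. Qed.

Lemma dotv_ge0 x : 0 <= dotv x x.
Proof. by rewrite dotvE; apply: sumr_ge0 => j _; rewrite -expr2 sqr_ge0. Qed.

Lemma dotv_eq0 x : (dotv x x == 0) = (x == 0).
Proof.
apply/eqP/eqP => [|->]; last by rewrite /dotv mul0mx mxE.
rewrite dotvE => /eqP; rewrite psumr_eq0; last by move=> j _; rewrite -expr2 sqr_ge0.
move=> /allP h; apply/rowP => j; rewrite mxE.
by have := h j (mem_index_enum j); rewrite -expr2 sqrf_eq0 => /eqP.
Qed.

Lemma mulmx_dotv x y : x *m y^T = (dotv x y)%:M.
Proof. by apply/matrixP => i j; rewrite !ord1 [RHS]mxE eqxx mulr1n. Qed.

Lemma sphere_neq0 x : sphere x -> x != 0.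
Proof. by rewrite /sphere/= => Sx; rewrite -dotv_eq0 Sx oner_eq0. Qed.

Lemma radial_sphere y : y != 0 -> sphere (radial y).
Proof.
move=> y0; rewrite /sphere/= /radial dotvZl dotvZr mulrA -invfM -expr2 sqr_sqrtr ?dotv_ge0//.
by rewrite mulVf// dotv_eq0.
Qed.

Lemma radial_id x : sphere x -> radial x = x.
Proof. by rewrite /sphere/= /radial => ->; rewrite sqrtr1 invr1 scale1r. Qed.

Lemma differentiable_dotv x : differentiable (fun y : E => dotv y y) x.
Proof.
rewrite (_ : (fun _ => _) = \sum_j (fun y : E => y 0 j * y 0 j)).
  by apply: differentiable_sum => j; apply: differentiableM; exact: differentiable_coord.
by apply/funext => y; rewrite dotvE (@fct_sumE _ _ R).
Qed.

Lemma differentiable_invnorm x : sphere x ->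
  differentiable (fun y : E => (Num.sqrt (dotv y y))^-1) x.
Proof.
move=> Sx; have q1 : dotv x x = 1 by [].
apply: differentiableV; last by rewrite q1 sqrtr1 oner_eq0.
apply: (differentiable_comp (differentiable_dotv x)).
by rewrite q1; apply/derivable1_diffP; have [] := is_derive1_sqrt (@ltr01 R).
Qed.

Lemma differentiable_radial x : sphere x -> differentiable radial x.
Proof.
move=> Sx; apply: differentiable_mx => i j.
rewrite (_ : (fun _ => _) = fun y => (Num.sqrt (dotv y y))^-1 * y 0 j); last first.
  by apply/funext => y; rewrite mxE ord1.
apply: differentiableM; last exact: differentiable_coord.
exact: differentiable_invnorm.
Qed.

Lemma near_sphere_neq0 x : sphere x -> \forall y \near x, y != 0.
Proof.
move=> /sphere_neq0 x0; have : `|x| > 0 by rewrite normr_gt0.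
move=> x1; have : (\forall y \near x, 0 < `|y|).
  have h := @norm_continuous R E x.
  exact: (cvgr_gt _ h).
by apply: filterS => y; rewrite normr_gt0.
Qed.

Lemma is_derive_coord x X j : is_derive x X (fun y : E => y 0 j) (X 0 j).
Proof. by have /is_derive_mxP := is_derive_id x X; apply. Qed.

Lemma is_derive_dotv (f g : E -> E) x X A B :
  is_derive x X f A -> is_derive x X g B ->
  is_derive x X (fun y => dotv (f y) (g y)) (dotv A (g x) + dotv (f x) B).
Proof.
move=> fA gB; have /is_derive_mxP/(_ 0 0) := is_derive_mulmx fA (is_derive_trmx gB).
by rewrite mxE.
Qed.

(** Write radial y = k(y) y with k = 1/|y|. Differentiating
    <radial, radial> = 1 shows that the derivative k' x + X is orthogonal to x,
    which for tangent X gives k' = 0. *)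
Lemma is_derive_radial x X : sphere x -> tangent x X -> is_derive x X radial X.
Proof.
move=> Sx Xx.
have dr : is_derive x X radial ('D_X radial x).
  by apply/derivableP/diff_derivable/differentiable_radial.
set D := 'D_X radial x in dr *.
have xD : dotv x D = 0.
  have h := is_derive_dotv dr dr.
  have : is_derive x X (fun y => dotv (radial y) (radial y)) 0.
    apply: (@near_eq_is_derive _ _ _ (cst 1 : E -> R)).
    by apply: filterS (near_sphere_neq0 Sx) => y /radial_sphere.
  move=> [_]; have [_ ->] := h; rewrite radial_id// [dotv D x]dotvC => /eqP.
  by rewrite -mulr2n mulrn_eq0 => /eqP.
have dk : is_derive x X (fun y => (Num.sqrt (dotv y y))^-1)
    ('D_X (fun y => (Num.sqrt (dotv y y))^-1) x).
  exact/derivableP/diff_derivable/differentiable_invnorm.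
set k := 'D_X _ x in dk.
have DE : D = k *: x + X.
  apply/rowP => j; have /is_derive_mxP/(_ 0 j)[_ <-] := dr.
  rewrite (_ : (fun _ => _) = fun y => (Num.sqrt (dotv y y))^-1 * y 0 j); last first.
    by apply/funext => y; rewrite mxE.
  have [_ ->] := is_derive_mulr dk (is_derive_coord x X j).
  have q1 : dotv x x = 1 by [].
  by rewrite !mxE q1 sqrtr1 invr1 mul1r.
move: xD; rewrite DE dotvDr dotvZr (_ : dotv x x = 1)// (_ : dotv x X = 0)//.
rewrite mulr1 addr0 => k0; rewrite k0 scale0r add0r in DE.
by rewrite -{2}DE.
Qed.

(** Composition with the radial projection makes any local smooth extension of f
    as good as f itself. *)
Lemma derivable_radial_comp (W : normedModType R) (f : E -> W) x X :
  smooth_sphere f -> sphere x -> derivable (f \o radial) x X.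
Proof.
move=> fS Sx; have [U [g [oU Ux gC fg]]] := fS x Sx.
have rx := radial_id Sx.
apply: (near_eq_derivable (f := g \o radial)); last first.
  apply: diff_derivable; apply: differentiable_comp.
    exact: differentiable_radial.
  by rewrite rx; have [+ _] := gC 1%N; apply.
have cr : {for x, continuous radial}.
  exact/differentiable_continuous/differentiable_radial.
have Unear : \forall y \near x, U (radial y).
  apply: cr; rewrite rx; exact: open_nbhs_nbhs.
apply: filterS2 Unear (near_sphere_neq0 Sx) => y Uy y0.
by rewrite /= fg//; exact: radial_sphere.
Qed.

Lemma is_dsphere (W : normedModType R) (f : E -> W) x X :
  smooth_sphere f -> sphere x -> is_derive x X (f \o radial) (dsphere f x X).
Proof. by move=> fS Sx; apply/derivableP/derivable_radial_comp. Qed.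

Lemma eq_dsphere (W : normedModType R) (f g : E -> W) x X :
  (forall y, sphere y -> f y = g y) -> sphere x -> dsphere f x X = dsphere g x X.
Proof.
move=> fg Sx; apply: near_eq_derive.
by apply: filterS (near_sphere_neq0 Sx) => y /radial_sphere/fg.
Qed.

Lemma is_derive_entry m n (F : E -> 'M[R]_(m, n)) x X A i j :
  is_derive x X F A -> is_derive x X (fun y => F y i j) (A i j).
Proof. by move=> /is_derive_mxP; apply. Qed.

Lemma dsphere_dotv (f g : E -> E) x X :
  smooth_sphere f -> smooth_sphere g -> sphere x ->
  dsphere (fun y => dotv (f y) (g y)) x X =
  dotv (dsphere f x X) (g x) + dotv (f x) (dsphere g x X).
Proof.
move=> fS gS Sx; apply: derive_val.
have := is_derive_dotv (is_dsphere X fS Sx) (is_dsphere X gS Sx).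
by rewrite /= radial_id.
Qed.

Lemma dsphere_coord (f : E -> E) x X j : smooth_sphere f -> sphere x ->
  dsphere (fun y => f y 0 j) x X = dsphere f x X 0 j.
Proof.
by move=> fS Sx; apply: derive_val; exact: is_derive_entry (is_dsphere X fS Sx).
Qed.

Lemma dsphere_coord_id x X j : sphere x -> tangent x X ->
  dsphere (fun y : E => y 0 j) x X = X 0 j.
Proof.
by move=> Sx Xx; apply: derive_val; exact: is_derive_entry (is_derive_radial Sx Xx).
Qed.

(** The tangential projection of the constant field X: it shows that tensorial
    identities proved for vector fields hold for arbitrary tangent vectors. *)
Definition tangent_extension X : E -> E := fun y => X - dotv y X *: y.

Lemma vfield_tangent_extension X : vfield (tangent_extension X).
Proof.
split=> [|y Sy]; last first.
  rewrite /tangent/= /tangent_extension dotvBr dotvZr (_ : dotv y y = 1)//.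
  by rewrite mulr1 subrr.
rewrite (_ : tangent_extension X = fun y => X + (y *m (- X)^T) *m y).
  apply: smooth_sphereD; first exact: smooth_sphere_cst.
  apply: smooth_sphere_mulmx; last exact: smooth_sphere_id.
  by apply: smooth_sphere_mulmx; [exact: smooth_sphere_id|exact: smooth_sphere_cst].
apply/funext => y; rewrite /tangent_extension mulmx_dotv mul_scalar_mx.
by rewrite -[- X]scaleN1r dotvZr mulN1r scaleNr.
Qed.

Lemma tangent_extensionE x X : tangent x X -> tangent_extension X x = X.
Proof.
by rewrite /tangent/= /tangent_extension => ->; rewrite scale0r subr0.
Qed.

(** * Uniqueness of the Levi-Civita connection *)

Section LeviCivita.
Variable nabla : (E -> E) -> (E -> E) -> E -> E.
Hypothesis lc : levi_civita nabla.

Definition defect V W x := nabla V W x - dsphere W x (V x).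

Lemma tangent_nabla V W x : vfield V -> vfield W -> sphere x ->
  tangent x (nabla V W x).
Proof.
move=> fV fW; have [_] := conn_vfield (lc_connection lc) fV fW; exact.
Qed.

(** Torsion-freeness tested on the ambient coordinate functions, for which the
    action of a vector field W is a coordinate of W. *)
Lemma defect_sym V W x : vfield V -> vfield W -> sphere x ->
  defect V W x = defect W V x.
Proof.
move=> fV fW Sx; apply/rowP => j.
have := lc_torsion_free lc fV fW (smooth_sphere_coord j) Sx.
have dfE Z f : vfield Z -> vfield f ->
    dfield Z (dfield f (fun y : E => y 0 j)) x = dsphere f x (Z x) 0 j.
  move=> fZ [fS fT]; rewrite /dfield -dsphere_coord//.
  by apply: eq_dsphere => // y Sy; rewrite dsphere_coord_id//; exact: fT.
have tT : tangent x (nabla V W x - nabla W V x).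
  by rewrite /tangent/= dotvBr !tangent_nabla// subrr.
rewrite (dfE V W fV fW) (dfE W V fW fV) /defect.
rewrite [dfield _ _ _](dsphere_coord_id j Sx tT).
move: (nabla V W x) (nabla W V x) (dsphere W x _) (dsphere V x _) => N N' D D'.
rewrite !mxE => /eqP; rewrite subr_eq => /eqP ->.
by rewrite addrAC [X in X + _]addrAC subrr sub0r addrC.
Qed.

(** The Euclidean derivative satisfies the same product rule for dotv as a
    metric connection. *)
Lemma defect_skew V W Z x : vfield V -> vfield W -> vfield Z -> sphere x ->
  dotv (defect V W x) (Z x) = - dotv (defect V Z x) (W x).
Proof.
move=> fV fW fZ Sx; have := lc_metric lc fV fW fZ Sx.
rewrite /dfield dsphere_dotv//; [|exact: fW.1|exact: fZ.1].
rewrite /defect.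
move: (nabla V W x) (nabla V Z x) (dsphere W x _) (dsphere Z x _) => N N' D D'.
rewrite !dotvBl ![dotv (W x) _]dotvC => h.
by apply/eqP; rewrite -subr_eq0 opprK addrACA -h -opprD subrr.
Qed.

(** The form <defect V W, Z> is symmetric in (V, W) and antisymmetric in
    (W, Z); alternating the two rules three times returns to the same arguments
    with the opposite sign. *)
Lemma defect_tangential V W Z x : vfield V -> vfield W -> vfield Z -> sphere x ->
  dotv (defect V W x) (Z x) = 0.
Proof.
move=> fV fW fZ Sx.
suff h : dotv (defect V W x) (Z x) = - dotv (defect V W x) (Z x).
  by apply/eqP; move/eqP: h; rewrite -addr_eq0 -mulr2n mulrn_eq0.
rewrite {1}(defect_skew fV fW fZ Sx) (defect_sym fV fZ Sx).
rewrite (defect_skew fZ fV fW Sx) (defect_sym fZ fW Sx).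
by rewrite (defect_skew fW fZ fV Sx) (defect_sym fW fV Sx) !opprK.
Qed.

(** The tangential part of the Euclidean derivative is the only candidate: the
    defect is orthogonal to all tangent vectors, in particular to its own
    tangential part u. *)
Lemma levi_civita_dsphere V W x : vfield V -> vfield W -> sphere x ->
  exists a, dsphere W x (V x) = nabla V W x + a *: x.
Proof.
move=> fV fW Sx; exists (dotv x (dsphere W x (V x))).
set D := dsphere W x (V x); set N := nabla V W x.
pose u := N - (D - dotv x D *: x).
have xx : dotv x x = 1 by [].
have tN : dotv x N = 0 by exact: tangent_nabla.
have tu : dotv x u = 0.
  by rewrite /u !dotvBr dotvZr xx mulr1 tN subrr subr0.
suff : u = 0 by move/eqP; rewrite subr_eq0 => /eqP ->; rewrite subrK.
have := defect_tangential fV fW (vfield_tangent_extension u) Sx.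
rewrite tangent_extensionE// => h.
apply/eqP; rewrite -dotv_eq0 {1}/u opprB addrA addrAC dotvDl dotvZl tu mulr0 addr0.
by apply/eqP.
Qed.

End LeviCivita.
End SphereCalculus.
(** * Real derivatives of complex matrix-valued maps *)

Section ComplexCalculus.
Context {R : realType} {V : normedModType R}.
Local Notation C := R[i].
Local Notation re := (@complex.Re R).
Local Notation im := (@complex.Im R).
Variables x v : V.

Lemma re_mul (z w : C) : re (z * w) = re z * re w - im z * im w.
Proof. by case: z; case: w. Qed.

Lemma re_add (z w : C) : re (z + w) = re z + re w.
Proof. by case: z; case: w. Qed.

Lemma im_add (z w : C) : im (z + w) = im z + im w.
Proof. by case: z; case: w. Qed.

Lemma im_mul (z w : C) : im (z * w) = re z * im w + im z * re w.
Proof. by case: z; case: w. Qed.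

(** The variable is real and only the values are complex, so a derivative is a
    pair of real ones, for the real and the imaginary part, as in dsphereC. *)
Definition is_cderive (f : V -> C) (a : C) :=
  is_derive x v (re \o f) (re a) /\ is_derive x v (im \o f) (im a).

Lemma is_cderive_eq f a b : is_cderive f a -> a = b -> is_cderive f b.
Proof. by move=> ? <-. Qed.

Lemma is_cderive_unique f a b : is_cderive f a -> is_cderive f b -> a = b.
Proof.
move=> [[_ ra] [_ ia]] [[_ rb] [_ ib]].
by apply/eqP; rewrite eq_complex -ra -ia -rb -ib !eqxx.
Qed.

Lemma is_cderive_cst c : is_cderive (fun=> c) 0.
Proof. by split; exact: is_derive_cst. Qed.

Lemma is_cderiveD f g a b : is_cderive f a -> is_cderive g b ->
  is_cderive (fun y => f y + g y) (a + b).
Proof.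
move=> [fr fi] [gr gi]; split; rewrite ?re_add ?im_add.
- rewrite (_ : _ \o _ = re \o f + (re \o g)); first exact: is_deriveD.
  by apply/funext => y; exact: re_add.
- rewrite (_ : _ \o _ = im \o f + (im \o g)); first exact: is_deriveD.
  by apply/funext => y; exact: im_add.
Qed.

Lemma is_cderiveM f g a b : is_cderive f a -> is_cderive g b ->
  is_cderive (fun y => f y * g y) (a * g x + f x * b).
Proof.
move=> [fr fi] [gr gi]; split.
- rewrite (_ : _ \o _ = (fun y => re (f y) * re (g y)) - (fun y => im (f y) * im (g y))).
    apply: is_derive_eq (is_deriveB (is_derive_mulr fr gr) (is_derive_mulr fi gi)) _.
    by rewrite re_add !re_mul opprD addrACA.
  by apply/funext => y; exact: re_mul.
- rewrite (_ : _ \o _ = (fun y => re (f y) * im (g y)) + (fun y => im (f y) * re (g y))).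
    apply: is_derive_eq (is_deriveD (is_derive_mulr fr gi) (is_derive_mulr fi gr)) _.
    by rewrite im_add !im_mul addrACA.
  by apply/funext => y; exact: im_mul.
Qed.

Lemma is_cderive_conj f a : is_cderive f a ->
  is_cderive (fun y => Num.conj (f y)) (Num.conj a).
Proof.
move=> [fr fi]; split.
- rewrite (_ : _ \o _ = re \o f); last by apply/funext => y /=; case: (f y).
  by rewrite (_ : re _ = re a)//; case: (a).
- rewrite (_ : _ \o _ = - (im \o f)); last first.
    by apply/funext => y; rewrite /= /GRing.opp /=; case: (f y).
  by rewrite (_ : im _ = - im a); [exact: is_deriveN|case: (a)].
Qed.

Lemma is_cderive_sum (I : Type) (r : seq I) (f : I -> V -> C) (df : I -> C) :
  (forall i, is_cderive (f i) (df i)) ->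
  is_cderive (fun y => \sum_(i <- r) f i y) (\sum_(i <- r) df i).
Proof.
move=> fd; elim: r => [|i r IH].
  rewrite big_nil (_ : (fun _ => _) = fun=> 0); first exact: is_cderive_cst.
  by apply/funext => y; rewrite big_nil.
rewrite big_cons (_ : (fun _ => _) = fun y => f i y + \sum_(i <- r) f i y).
  exact: is_cderiveD.
by apply/funext => y; rewrite big_cons.
Qed.

Definition cderivable (f : V -> C) := exists a, is_cderive f a.

Lemma cderivable_cst c : cderivable (fun=> c).
Proof. by exists 0; exact: is_cderive_cst. Qed.

Lemma cderivableM f g : cderivable f -> cderivable g ->
  cderivable (fun y => f y * g y).
Proof. by move=> [a fa] [b gb]; eexists; exact: is_cderiveM fa gb. Qed.

Lemma cderivable_sum (I : Type) (r : seq I) (f : I -> V -> C) :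
  (forall i, cderivable (f i)) -> cderivable (fun y => \sum_(i <- r) f i y).
Proof.
move=> fd; have [df fdf] := choice fd.
by eexists; exact: is_cderive_sum.
Qed.

Lemma cderivable_prod (I : Type) (r : seq I) (f : I -> V -> C) :
  (forall i, cderivable (f i)) -> cderivable (fun y => \prod_(i <- r) f i y).
Proof.
move=> fd; elim: r => [|i r IH].
  rewrite (_ : (fun _ => _) = fun=> 1); first exact: cderivable_cst.
  by apply/funext => y; rewrite big_nil.
rewrite (_ : (fun _ => _) = fun y => f i y * \prod_(i <- r) f i y).
  exact: cderivableM.
by apply/funext => y; rewrite big_cons.
Qed.

Lemma cderivableV f : f x != 0 -> cderivable f -> cderivable (fun y => (f y)^-1).
Proof.
move=> fx0 [a [fr fi]].
pose n y := re (f y) * re (f y) + im (f y) * im (f y).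
have n0 : n x != 0.
  apply: contra fx0; rewrite /n -!expr2 paddr_eq0 ?sqr_ge0// !sqrf_eq0.
  by move=> /andP[r0 i0]; rewrite eq_complex/= r0 i0.
have dn : derivable n x v.
  by have [] := is_deriveD (is_derive_mulr fr fr) (is_derive_mulr fi fi).
have /derivableP dV := derivableV n0 dn.
exists ('D_v (fun y => re (f y) * (n y)^-1) x +i* 'D_v (fun y => - im (f y) * (n y)^-1) x).
split.
- rewrite (_ : _ \o _ = (fun y => re (f y) * (n y)^-1)).
    by apply/derivableP; have [] := is_derive_mulr fr dV.
  by apply/funext => y; rewrite /= /n; case: (f y) => p q /=; rewrite !expr2.
- rewrite (_ : _ \o _ = (fun y => - im (f y) * (n y)^-1)).
    by apply/derivableP; have [] := is_derive_mulr (is_deriveN fi) dV.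
  by apply/funext => y; rewrite /= /n; case: (f y) => p q /=; rewrite !expr2 mulNr.
Qed.

Definition is_mcderive m n (F : V -> 'M[C]_(m, n)) (A : 'M[C]_(m, n)) :=
  forall i j, is_cderive (fun y => F y i j) (A i j).

Definition mcderivable m n (F : V -> 'M[C]_(m, n)) :=
  forall i j, cderivable (fun y => F y i j).

Lemma mcderivableP m n (F : V -> 'M[C]_(m, n)) :
  mcderivable F <-> exists A, is_mcderive F A.
Proof.
split=> [FA|[A FA] i j]; last by exists (A i j); exact: FA.
exists (\matrix_(i, j) sval (cid (FA i j))) => i j; rewrite mxE.
exact: svalP (cid (FA i j)).
Qed.

Lemma is_mcderive_unique m n (F : V -> 'M[C]_(m, n)) A B :
  is_mcderive F A -> is_mcderive F B -> A = B.
Proof.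
by move=> FA FB; apply/matrixP => i j; exact: is_cderive_unique (FA i j) (FB i j).
Qed.

Lemma is_mcderive_cst m n (A : 'M[C]_(m, n)) : is_mcderive (fun=> A) 0.
Proof. by move=> i j; rewrite mxE; exact: is_cderive_cst. Qed.

Lemma is_mcderiveD m n (F G : V -> 'M[C]_(m, n)) A B :
  is_mcderive F A -> is_mcderive G B -> is_mcderive (fun y => F y + G y) (A + B).
Proof.
move=> FA GB i j; rewrite mxE (_ : (fun _ => _) = fun y => F y i j + G y i j).
  exact: is_cderiveD.
by apply/funext => y; rewrite mxE.
Qed.

Lemma is_mcderive_mulmx m n p (F : V -> 'M[C]_(m, n)) (G : V -> 'M[C]_(n, p)) A B :
  is_mcderive F A -> is_mcderive G B ->
  is_mcderive (fun y => F y *m G y) (A *m G x + F x *m B).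
Proof.
move=> FA GB i k.
rewrite (_ : (fun _ => _) = fun y => \sum_j F y i j * G y j k); last first.
  by apply/funext => y; rewrite mxE.
rewrite !mxE -big_split/=; apply: is_cderive_sum => j.
exact: is_cderiveM.
Qed.

Lemma is_mcderiveZ m n c (F : V -> 'M[C]_(m, n)) A :
  is_mcderive F A -> is_mcderive (fun y => c *: F y) (c *: A).
Proof.
move=> FA i j; rewrite mxE (_ : (fun _ => _) = fun y => c * F y i j).
  by apply: is_cderive_eq (is_cderiveM (is_cderive_cst c) (FA i j)) _; rewrite mul0r add0r.
by apply/funext => y; rewrite mxE.
Qed.

Lemma is_mcderive_adj m n (F : V -> 'M[C]_(m, n)) A :
  is_mcderive F A -> is_mcderive (fun y => (F y) ^t*) (A ^t*).
Proof.
move=> FA i j; rewrite !mxE (_ : (fun _ => _) = fun y => Num.conj (F y j i)).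
  exact: is_cderive_conj.
by apply/funext => y; rewrite !mxE.
Qed.

Lemma is_mcderive_toC m n (F : V -> 'M[R]_(m, n)) A :
  is_derive x v F A -> is_mcderive (fun y => toC (F y)) (toC A).
Proof.
move=> /is_derive_mxP FA i j; split; rewrite mxE /=.
- rewrite (_ : _ \o _ = fun y => F y i j)//.
  by apply/funext => y; rewrite /= mxE.
- rewrite (_ : _ \o _ = cst 0); first exact: is_derive_cst.
  by apply/funext => y; rewrite /= mxE.
Qed.

Lemma mcderivable_det n (F : V -> 'M[C]_n) :
  mcderivable F -> cderivable (fun y => \det (F y)).
Proof.
move=> FA; rewrite /determinant; apply: cderivable_sum => s; apply: cderivableM; first exact: cderivable_cst.
by apply: cderivable_prod => i; exact: FA.
Qed.

Lemma mcderivable_adjugate n (F : V -> 'M[C]_n) :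
  mcderivable F -> mcderivable (fun y => \adj (F y)).
Proof.
move=> FA i j.
rewrite (_ : (fun _ => _) =
   fun y => (-1) ^+ (j + i) * \det (row' j (col' i (F y)))); last first.
  by apply/funext => y; rewrite mxE.
apply: cderivableM; first exact: cderivable_cst.
apply: mcderivable_det => k l.
by rewrite (_ : (fun _ => _) = fun y => F y (lift j k) (lift i l));
  [exact: FA|apply/funext => y; rewrite !mxE].
Qed.

Lemma mcderivable_mulmx m n p (F : V -> 'M[C]_(m, n)) (G : V -> 'M[C]_(n, p)) :
  mcderivable F -> mcderivable G -> mcderivable (fun y => F y *m G y).
Proof.
move=> /mcderivableP[A FA] /mcderivableP[B GB]; apply/mcderivableP.
by eexists; exact: is_mcderive_mulmx.
Qed.

(** By Cramer's rule the entries of P are near x quotients of polynomials in the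
    entries of M and Q, so no regularity of P has to be known in advance. *)
Lemma mcderivable_solve n (M Q P : V -> 'M[C]_n) :
  (\forall y \near x, M y \in unitmx /\ M y *m P y = Q y) ->
  mcderivable M -> mcderivable Q -> mcderivable P.
Proof.
move=> MPQ dM dQ i j.
have [a [ar ai]] : cderivable (fun y => (\det (M y))^-1 * (\adj (M y) *m Q y) i j).
  apply: cderivableM.
    apply: cderivableV; last exact: mcderivable_det.
    by have [] := nbhs_singleton MPQ; rewrite unitmxE unitfE.
  by apply: mcderivable_mulmx => //; exact: mcderivable_adjugate.
have PE : \forall y \near x, (\det (M y))^-1 * (\adj (M y) *m Q y) i j = P y i j.
  apply: filterS MPQ => y [yU yE].
  have y0 : \det (M y) != 0 by rewrite -unitfE -unitmxE.
  by rewrite -yE mulmxA mul_adj_mx mul_scalar_mx mxE mulrA mulVf ?mul1r.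
by exists a; split; [apply: near_eq_is_derive ar|apply: near_eq_is_derive ai];
  apply: filterS PE => y /= ->.
Qed.

End ComplexCalculus.
(** * Complexification *)

Section ToC.
Context {R : realType}.
Local Notation C := R[i].

Lemma toCM m n p (A : 'M[R]_(m, n)) (B : 'M[R]_(n, p)) :
  toC (A *m B) = toC A *m toC B.
Proof. exact: map_mxM. Qed.

Lemma toCD m n (A B : 'M[R]_(m, n)) : toC (A + B) = toC A + toC B.
Proof. exact: map_mxD. Qed.

Lemma toCB m n (A B : 'M[R]_(m, n)) : toC (A - B) = toC A - toC B.
Proof. exact: map_mxB. Qed.

Lemma toCN m n (A : 'M[R]_(m, n)) : toC (- A) = - toC A.
Proof. exact: map_mxN. Qed.

Lemma toCZ m n a (A : 'M[R]_(m, n)) : toC (a *: A) = real_complex R a *: toC A.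
Proof. exact: map_mxZ. Qed.

Lemma toC0 m n : toC (0 : 'M[R]_(m, n)) = 0.
Proof. exact: map_mx0. Qed.

Lemma toC1 n : toC (1%:M : 'M[R]_n) = 1%:M.
Proof. exact: map_mx1. Qed.

Lemma toC_trmx m n (A : 'M[R]_(m, n)) : toC A^T = (toC A)^T.
Proof. by rewrite /toC map_trmx. Qed.

Lemma toC_row m n (A : 'M[R]_(m, n)) i : toC (row i A) = row i (toC A).
Proof. by rewrite /toC map_row. Qed.

Lemma toC_pair_inj m n (A B D F : 'M[R]_(m, n)) :
  toC A + 'i%C *: toC B = toC D + 'i%C *: toC F -> A = D /\ B = F.
Proof.
move=> /matrixP E.
by split; apply/matrixP => i j; have := E i j; rewrite !mxE => /eqP;
  rewrite eq_complex/= !(mul0r, mul1r, mulr0, subr0, subrr, addr0, add0r);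
  move=> /andP[/eqP ? /eqP ?].
Qed.

Lemma mulii : 'i%C * 'i%C = -1 :> R[i].
Proof. by rewrite -expr2 sqr_i. Qed.

End ToC.

Lemma dsphereC_derive (R : realType) d m n (f : 'rV[R]_d -> 'M[R[i]]_(m, n))
    x X A :
  is_mcderive x X (f \o radial) A -> dsphereC f x X = A.
Proof.
move=> fA; rewrite /dsphereC /dsphere.
have reE : is_derive x X ((fun y => map_mx (@complex.Re R) (f y)) \o radial)
    (map_mx (@complex.Re R) A).
  apply/is_derive_mxP => i j; rewrite mxE.
  have [+ _] := fA i j; congr (is_derive _ _ _ _).
  by apply/funext => y; rewrite /= mxE.
have imE : is_derive x X ((fun y => map_mx (@complex.Im R) (f y)) \o radial)
    (map_mx (@complex.Im R) A).
  apply/is_derive_mxP => i j; rewrite mxE.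
  have [_] := fA i j; congr (is_derive _ _ _ _).
  by apply/funext => y; rewrite /= mxE.
have [_ ->] := reE; have [_ ->] := imE.
apply/matrixP => i j; rewrite !mxE; case: (A i j) => a b.
by apply/eqP; rewrite eq_complex/= !(mul0r, mul1r, mulr0, subr0, addr0, add0r) !eqxx.
Qed.

(** * Orthogonal projections and the Grassmannian *)

Section OrthogonalProjection.
Context {R : realType} {N : nat}.
Local Notation C := R[i].
Implicit Types (P Q : 'M[C]_N).

Lemma adjM m n p (A : 'M[C]_(m, n)) (B : 'M[C]_(n, p)) :
  (A *m B) ^t* = B ^t* *m A ^t*.
Proof. by rewrite trmx_mul map_mxM. Qed.

Lemma adjB m n (A B : 'M[C]_(m, n)) : (A - B) ^t* = A ^t* - B ^t*.
Proof. by rewrite linearB /= map_mxB. Qed.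

Lemma mulmx_adj_eq0 (v : 'rV[C]_N) : v *m v ^t* = 0 -> v = 0.
Proof.
move=> vv; apply/eqP; apply: contraT => /dotmx_is_dotmx.
by rewrite dotmxE vv mxE ltxx.
Qed.

(** Here P is the orthogonal and Q any other projection with the same range;
    then P = (Q + Q^* - 1)^-1 Q. Taking adjoints in P Q = P gives Q^* P = P,
    whence the equation; if v (Q + Q^* - 1) = 0, the equation gives v Q = 0, so
    v = v Q^* and v v^* = v Q^* v^* = v (v Q)^* = 0. *)
Lemma orthogonal_projection_formula P Q :
  P ^t* = P -> P *m Q = P -> Q *m P = Q ->
  Q + Q ^t* - 1%:M \in unitmx /\ (Q + Q ^t* - 1%:M) *m P = Q.
Proof.
move=> Ph PQ QP.
have QsP : Q ^t* *m P = P by rewrite -{1}Ph -adjM PQ.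
have MP : (Q + Q ^t* - 1%:M) *m P = Q by rewrite mulmxBl mulmxDl QP QsP mul1mx addrK.
split=> //; rewrite -row_free_unit -kermx_eq0; apply/rowV0P => v /sub_kermxP vM.
have vQ : v *m Q = 0 by rewrite -MP mulmxA vM mul0mx.
have vE : v = v *m Q ^t*.
  by move/eqP: vM; rewrite mulmxBr mulmxDr vQ add0r mulmx1 subr_eq0 => /eqP.
by apply: mulmx_adj_eq0; rewrite {1}vE -mulmxA -adjM vQ trmx0 map_mx0 mulmx0.
Qed.

(** The part of A that maps the range of P to its kernel is the only one seen by
    rows Z in the range of P, and on it K is multiplication by i. *)
Lemma mulmx_grassK m (Z : 'M[C]_(m, N)) P A : P *m P = P -> grass_tangent P A ->
  Z *m P = Z -> Z *m grassK P A = 'i%C *: (Z *m A).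
Proof.
move=> PP tA ZP; have [PAP ->] := grassKE PP tA.
rewrite -scalemxAr mulmxBr !mulmxA ZP.
by rewrite -[X in _ - X *m _ *m _]ZP -!mulmxA [P *m _]mulmxA PAP mulmx0 subr0.
Qed.

Lemma grass_tangentB P A B : grass_tangent P A -> grass_tangent P B ->
  grass_tangent P (A - B).
Proof.
move=> [Ah AP PA] [Bh BP PB]; split; first by rewrite adjB Ah Bh.
  by rewrite mulmxBl AP BP mulmxBr.
by rewrite mulmxBr PA PB mulmxBl.
Qed.

(** A P = (P A)^* = 0 as well, and the tangency condition A P = (1 - P) A leaves
    nothing else. *)
Lemma grass_tangent_eq0 P A : P ^t* = P -> grass_tangent P A ->
  P *m A = 0 -> A = 0.
Proof.
move=> Ph [Ah AP _] PA; have AP0 : A *m P = 0.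
  by rewrite -Ah -Ph -adjM PA trmx0 map_mx0.
by move: AP; rewrite AP0 mulmxBl mul1mx PA subr0.
Qed.

End OrthogonalProjection.

(** * The projection onto T01 + N *)

Section InducedProjection.
Context {R : realType} {d : nat}.
Local Notation E := 'rV[R]_d.
Local Notation C := R[i].
Variable J : E -> 'M[R]_d.
Hypothesis acJ : almost_complex J.
Implicit Types (x y X Y : E).

Lemma tangent_mulmx m (A : 'M[R]_(m, d)) y : sphere y -> A *m y^T = 0 ->
  A *m J y *m y^T = 0 /\ A *m J y *m J y = - A.
Proof.
move=> Sy Ay.
have tA i : tangent y (row i A).
  rewrite /tangent/= dotvC /dotv.
  by rewrite -row_mul Ay row0 mxE.
split; apply/row_matrixP => i; rewrite !row_mul.
  rewrite mulmx_dotv dotvC (_ : dotv _ _ = 0) ?row0 ?raddf0//.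
  exact: (acs_tangent acJ Sy (tA i)).
by rewrite (acs_square acJ Sy (tA i)) linearN.
Qed.

Lemma tangent_actJ y Y : sphere y -> tangent y Y -> tangent y (Y *m J y).
Proof. by move=> Sy; exact: (acs_tangent acJ Sy). Qed.

Definition tangent_proj y : 'M[R]_d := 1%:M - y^T *m y.

(** The projection onto T01 + N along T10: on tangent vectors (1 + iJ)/2 is the
    eigenprojection of J for the eigenvalue -i. *)
Definition oblique_proj y : 'M[C]_d :=
  toC (y^T *m y) + 2^-1 *: (toC (tangent_proj y) *m (1%:M + 'i%C *: toC (J y))).

Lemma tangent_proj_normal y : sphere y -> y *m tangent_proj y = 0.
Proof.
by move=> Sy; rewrite mulmxBr mulmx1 mulmxA mulmx_dotv (_ : dotv y y = 1)// mul1mx subrr.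
Qed.

Lemma tangent_proj_tangent y : sphere y -> tangent_proj y *m y^T = 0.
Proof.
move=> Sy; apply: trmx_inj; rewrite trmx_mul trmxK trmx0.
by rewrite linearB/= trmx1 trmx_mul trmxK; exact: tangent_proj_normal.
Qed.

Lemma T01_tangent m (A : 'M[R]_(m, d)) y : sphere y -> A *m y^T = 0 ->
  ((toC A + 'i%C *: toC (A *m J y))%R <= T01 J y)%MS.
Proof.
move=> Sy Ay; have [AJy AJJ] := tangent_mulmx Sy Ay; rewrite sub_capmx; apply/andP; split.
  apply/sub_kermxP; rewrite -toC_trmx mulmxDl -scalemxAl -!toCM.
  by rewrite Ay AJy toC0 scaler0 addr0.
apply/eigenspaceP; rewrite mulmxDl -scalemxAl -!toCM AJJ toCN scalerDr scalerA.
by rewrite mulNr mulii opprK scale1r scalerN scaleNr addrC.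
Qed.

Lemma oblique_proj_sub y : sphere y -> (oblique_proj y <= T01 J y + toC y)%MS.
Proof.
move=> Sy; rewrite /oblique_proj addrC; apply: addmx_sub_adds.
  apply: scalemx_sub; rewrite mulmxDr mulmx1 -scalemxAr -toCM.
  exact: (T01_tangent Sy (tangent_proj_tangent Sy)).
by rewrite toCM submxMl.
Qed.

Lemma oblique_proj_id y : sphere y ->
  (T01 J y + toC y)%MS *m oblique_proj y = (T01 J y + toC y)%MS.
Proof.
move=> Sy; apply/eqP; rewrite -subr_eq0 -[X in _ - X]mulmx1 -mulmxBr; apply/eqP/sub_kermxP.
rewrite addsmx_sub; apply/andP; split; apply/sub_kermxP; apply/eqP;
  rewrite mulmxBr mulmx1 subr_eq0; apply/eqP.
- have [/sub_kermxP Ty /eigenspaceP TJ] :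
      (T01 J y <= kermx (toC y)^T)%MS /\ (T01 J y <= eigenspace (toC (J y)) (- 'i%C))%MS.
    by split; [exact: capmxSl|exact: capmxSr].
  rewrite /oblique_proj (mulmxDr (T01 J y)) toCM mulmxA toC_trmx Ty mul0mx add0r.
  rewrite -scalemxAr /tangent_proj toCB toC1 toCM mulmxA mulmxBr mulmx1 mulmxA toC_trmx Ty.
  rewrite mul0mx subr0 mulmxDr mulmx1 -scalemxAr TJ scalerA mulrN mulii opprK scale1r.
  by rewrite -mulr2n -[X in _ *: X]scaler_nat scalerA mulVf ?scale1r// pnatr_eq0.
- rewrite /oblique_proj (mulmxDr (toC y)) -scalemxAr mulmxA -!toCM tangent_proj_normal// toC0 mul0mx.
  by rewrite scaler0 addr0 mulmxA mulmx_dotv (_ : dotv y y = 1)// mul1mx.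
Qed.

Lemma Pperp_idem y : Pperp J y *m Pperp J y = Pperp J y.
Proof. exact: proj_ortho_proj. Qed.

Lemma Pperp_adj y : (Pperp J y) ^t* = Pperp J y.
Proof. by have [] := proj_ortho_grassmannian (T01 J y + toC y)%MS. Qed.

Lemma Pperp_oblique y : sphere y ->
  Pperp J y *m oblique_proj y = Pperp J y.
Proof.
move=> Sy; have : (Pperp J y <= T01 J y + toC y)%MS by rewrite proj_orthoE.
by case/submxP => D ->; rewrite -mulmxA oblique_proj_id.
Qed.

Lemma oblique_Pperp y : sphere y ->
  oblique_proj y *m Pperp J y = oblique_proj y.
Proof. by move=> Sy; apply: proj_ortho_id; exact: oblique_proj_sub. Qed.

Lemma Pperp_normal y : toC y *m Pperp J y = toC y.
Proof. by apply: proj_ortho_id; exact: addsmxSr. Qed.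

Lemma Pperp_T01 y Y : sphere y -> tangent y Y ->
  (toC Y + 'i%C *: toC (Y *m J y)) *m Pperp J y = toC Y + 'i%C *: toC (Y *m J y).
Proof.
move=> Sy tY; apply: proj_ortho_id.
apply: (submx_trans (T01_tangent Sy _)) (addsmxSl _ _).
by rewrite mulmx_dotv dotvC (_ : dotv y Y = 0)// raddf0.
Qed.

(** If Y lies in T01 + N then the oblique projection fixes it, so
    Y = (Y + iJY)/2, and the real part of this reads Y = Y/2. *)
Lemma Pperp_real_tangent y Y : sphere y -> tangent y Y ->
  toC Y *m Pperp J y = toC Y -> Y = 0.
Proof.
move=> Sy tY YP.
have : toC Y *m oblique_proj y = toC Y by rewrite -YP -mulmxA Pperp_oblique.
have Yy : Y *m y^T = 0 by rewrite mulmx_dotv dotvC (_ : dotv y Y = 0)// raddf0.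
rewrite /oblique_proj (mulmxDr (toC Y)) -scalemxAr mulmxA -!toCM mulmxA Yy mul0mx toC0 add0r.
rewrite mulmxBr mulmx1 mulmxA Yy mul0mx subr0 mulmxDr mulmx1 -scalemxAr -toCM.
move=> /(congr1 (fun A => 2 *: A)); rewrite scalerA divff ?pnatr_eq0// scale1r => h.
have [//] : Y = Y + Y /\ Y *m J y = 0.
  by apply: toC_pair_inj; rewrite h toC0 scaler0 addr0 scaler_nat mulr2n toCD.
by move=> /eqP; rewrite -subr_eq0 opprD addrA subrr add0r oppr_eq0 => /eqP.
Qed.

End InducedProjection.
(** * The derivative of the projection *)

Section InducedProjectionDerivative.
Context {R : realType} {d : nat}.
Local Notation E := 'rV[R]_d.
Local Notation C := R[i].
Variable J : E -> 'M[R]_d.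
Hypothesis acJ : almost_complex J.
Implicit Types (x y X Y : E).

Local Notation P := (Pperp J).
Local Notation dP := (dsphereC P).

Lemma is_mcderive_near m n (F G : E -> 'M[C]_(m, n)) x X A :
  (\forall y \near x, F y = G y) -> is_mcderive x X F A -> is_mcderive x X G A.
Proof.
move=> FG FA i j; have [r s] := FA i j.
by split; [apply: near_eq_is_derive r|apply: near_eq_is_derive s];
  apply: filterS FG => y /= ->.
Qed.

Lemma mcderivable_oblique x X : sphere x -> tangent x X ->
  mcderivable x X (oblique_proj J \o radial).
Proof.
move=> Sx Xx; apply/mcderivableP.
have dr := is_derive_radial Sx Xx.
have dJ := is_dsphere X (acs_smooth acJ) Sx.
have drr := is_derive_mulmx (is_derive_trmx dr) dr.
eexists; apply: is_mcderiveD; first exact: is_mcderive_toC drr.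
apply: is_mcderiveZ; apply: is_mcderive_mulmx; last first.
  apply: is_mcderiveD; first exact: is_mcderive_cst.
  by apply: is_mcderiveZ; exact: is_mcderive_toC dJ.
apply: is_mcderive_toC; exact: (is_deriveB (is_derive_cst _ _ _) drr).
Qed.

Lemma is_mcderive_Pperp x X : sphere x -> tangent x X ->
  is_mcderive x X (P \o radial) (dP x X).
Proof.
move=> Sx Xx; have dQ := mcderivable_oblique Sx Xx.
suff /mcderivableP[A PA] : mcderivable x X (P \o radial).
  by rewrite (dsphereC_derive PA).
have [B QB] := (mcderivableP _ _ _).1 dQ.
apply: (@mcderivable_solve _ _ _ _ _
  (fun y => oblique_proj J (radial y) + (oblique_proj J (radial y)) ^t* - 1%:M) _ _ _ _ dQ).
  apply: filterS (near_sphere_neq0 Sx) => y /radial_sphere Sy /=.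
  apply: orthogonal_projection_formula; first exact: Pperp_adj.
    exact: Pperp_oblique.
  exact: oblique_Pperp.
apply/mcderivableP; eexists.
apply: is_mcderiveD; last exact: is_mcderive_cst.
by apply: is_mcderiveD; [exact: QB|exact: is_mcderive_adj QB].
Qed.

Lemma dPperp_tangent x X : sphere x -> tangent x X ->
  grass_tangent (P x) (dP x X).
Proof.
move=> Sx Xx; have PA := is_mcderive_Pperp Sx Xx.
have rx := radial_id Sx.
have Ah : (dP x X) ^t* = dP x X.
  apply: is_mcderive_unique (is_mcderive_adj PA) _.
  by apply: is_mcderive_near PA; near=> y; rewrite /= Pperp_adj.
have PE : dP x X *m P x + P x *m dP x X = dP x X.
  apply: (is_mcderive_unique (x := x) (v := X) _ PA).
  have := is_mcderive_mulmx PA PA; rewrite /= rx.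
  by apply: is_mcderive_near; near=> y; rewrite Pperp_idem.
split; first exact: Ah.
  by rewrite mulmxBl mul1mx -{2}PE addrK.
by rewrite mulmxBr mulmx1 -{2}PE addrAC subrr add0r.
Unshelve. all: by end_near. Qed.

(** The product rule for F P = F gives B P + F dP = B. *)
Lemma dPperp_fixed m (F : E -> 'M[C]_(m, d)) x X B :
  sphere x -> tangent x X ->
  (forall y, sphere y -> F y *m P y = F y) ->
  is_mcderive x X (F \o radial) B ->
  F x *m dP x X = B *m (1%:M - P x).
Proof.
move=> Sx Xx FP FB; have rx := radial_id Sx.
have := is_mcderive_mulmx FB (is_mcderive_Pperp Sx Xx); rewrite /= rx => h.
have BE : B *m P x + F x *m dP x X = B.
  apply: (is_mcderive_unique (x := x) (v := X) _ FB).
  apply: is_mcderive_near h.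
  by apply: filterS (near_sphere_neq0 Sx) => y /radial_sphere/FP.
by rewrite mulmxBr mulmx1 -{1}BE addrAC subrr add0r.
Qed.

(** U and U' stand for the two derivatives, so that they can be supplied in the
    form in which they have been computed. *)
Lemma dbar_fixed m (Z U U' : 'M[C]_(m, d)) x X : sphere x -> tangent x X ->
  Z *m P x = Z -> Z *m dP x X = U -> Z *m dP x (X *m J x) = U' ->
  Z *m dbar J P x X = U' - 'i%C *: U.
Proof.
move=> Sx Xx ZP <- <-; rewrite /dbar mulmxBr; congr (_ - _).
exact: mulmx_grassK (Pperp_idem J x) (dPperp_tangent Sx Xx) ZP.
Qed.

Lemma dPperp_normal x X : sphere x -> tangent x X ->
  toC x *m dP x X = toC X *m (1%:M - P x).
Proof.
move=> Sx Xx; apply: (@dPperp_fixed _ (fun y => toC y)) => //.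
  by move=> y _; exact: Pperp_normal.
exact: is_mcderive_toC (is_derive_radial Sx Xx).
Qed.

(** Y + iJY lies in T01, which 1 - P kills. *)
Lemma T01_compl x Y : sphere x -> tangent x Y ->
  'i%C *: toC (Y *m J x) *m (1%:M - P x) = - toC Y *m (1%:M - P x).
Proof.
move=> Sx Yx; apply/eqP; rewrite -subr_eq0 -mulmxBl opprK addrC mulmxBr mulmx1.
by rewrite Pperp_T01// subrr.
Qed.

(** T01_compl multiplied by -i: modulo T01, J acts on tangent vectors as i. *)
Lemma mulJ_compl x Y : sphere x -> tangent x Y ->
  toC (Y *m J x) *m (1%:M - P x) = 'i%C *: toC Y *m (1%:M - P x).
Proof.
move=> Sx Yx; have := T01_compl Sx Yx.
move=> /(congr1 (fun A => - 'i%C *: A)).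
rewrite -!scalemxAl scalerA mulNr mulii opprK scale1r => ->.
by rewrite mulNmx scalerN scaleNr opprK.
Qed.

Lemma dbar_normal x X : sphere x -> tangent x X ->
  toC x *m dbar J P x X = 0.
Proof.
move=> Sx Xx; rewrite (dbar_fixed Sx Xx (Pperp_normal J x) (dPperp_normal Sx Xx)
  (dPperp_normal Sx (tangent_actJ acJ Sx Xx))).
by rewrite (mulJ_compl Sx Xx) -scalemxAl subrr.
Qed.

Lemma vfield_actJ V : vfield V -> vfield (actJ J V).
Proof.
move=> [sV tV]; split; first exact: smooth_sphere_mulmx sV (acs_smooth acJ).
by move=> x Sx; apply: tangent_actJ => //; exact: tV.
Qed.

Variable nabla : (E -> E) -> (E -> E) -> E -> E.
Hypothesis lc : levi_civita nabla.

Lemma tangent_covJ V W x : vfield V -> vfield W -> sphere x ->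
  tangent x (covJ nabla J V W x).
Proof.
move=> fV fW Sx; rewrite /tangent/= /covJ dotvBr.
rewrite (_ : dotv x (nabla V _ x) = 0); last first.
  by apply: (tangent_nabla lc fV (vfield_actJ fW) Sx).
rewrite (_ : dotv x _ = 0) ?subrr//.
exact: (tangent_actJ acJ Sx (tangent_nabla lc fV fW Sx)).
Qed.

(** dPperp_fixed for F = W + iJW. In d_X F only the tangential parts survive;
    nabla_X (JW) contributes (nabla_X J)W + J nabla_X W, and
    nabla_X W + iJ nabla_X W lies in T01. *)
Lemma dPperp_T01 V W x : vfield V -> vfield W -> sphere x ->
  (toC (W x) + 'i%C *: toC (W x *m J x)) *m dP x (V x) =
  'i%C *: toC (covJ nabla J V W x) *m (1%:M - P x).
Proof.
move=> fV fW Sx; have tV := fV.2 x Sx.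
have fJW := vfield_actJ fW.
have dW := is_dsphere (V x) fW.1 Sx.
have dJW := is_dsphere (V x) fJW.1 Sx.
rewrite (@dPperp_fixed _ (fun y => toC (W y) + 'i%C *: toC (W y *m J y)) x (V x)
  (toC (dsphere W x (V x)) + 'i%C *: toC (dsphere (actJ J W) x (V x))))//; last 2 first.
- by move=> y Sy; apply: Pperp_T01 => //; exact: fW.2.
- apply: is_mcderiveD; first exact: is_mcderive_toC.
  by apply: is_mcderiveZ; exact: is_mcderive_toC.
have [a ->] := levi_civita_dsphere lc fV fW Sx.
have [b ->] := levi_civita_dsphere lc fV fJW Sx.
have tN := tangent_nabla lc fV fW Sx.
have xP : toC x *m (1%:M - P x) = 0 by rewrite mulmxBr mulmx1 Pperp_normal subrr.
rewrite (_ : nabla V (actJ J W) x = covJ nabla J V W x + nabla V W x *m J x); last first.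
  by rewrite /covJ subrK.
have := T01_compl Sx tN; move: xP.
move: (nabla V W x) (covJ _ _ _ _ _) (1%:M - P x) => v c Q xQ vQ.
rewrite !toCD !toCZ.
move: (toC v) (toC c) (toC x) (toC (v *m J x)) vQ xQ => v' c' x' w' vQ xQ.
rewrite !scalerDr 4!mulmxDl -!scalemxAl xQ !scaler0 !addr0 !scalemxAl.
by rewrite vQ mulNmx addrC -addrA addNr addr0.
Qed.

Lemma dbar_T01 V W x : vfield V -> vfield W -> sphere x ->
  (toC (W x) + 'i%C *: toC (W x *m J x)) *m dbar J P x (V x) =
  toC (tangent_algebra nabla J V W x *m J x) *m (1%:M - P x).
Proof.
move=> fV fW Sx; have tV := fV.2 x Sx; have fJV := vfield_actJ fV.
rewrite (dbar_fixed Sx tV (Pperp_T01 acJ Sx (fW.2 x Sx))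
  (dPperp_T01 fV fW Sx) (dPperp_T01 fJV fW Sx)).
have := mulJ_compl Sx (tangent_covJ fJV fW Sx).
have := acs_square acJ Sx (tangent_covJ fV fW Sx).
rewrite /tangent_algebra.
move: (covJ nabla J V W x) (covJ nabla J (actJ J V) W x) (1%:M - P x) => c c' Q cJJ c'Q.
rewrite mulmxBl cJJ opprK toCD mulmxDl c'Q -!scalemxAl scalerA mulii.
by rewrite scaleN1r opprK.
Qed.

(** x and the vectors Y + iJY span the range of P, because the rows of the
    oblique projection are combinations of vectors of these forms; the tangency
    of dbar P to the Grassmannian does the rest. *)
Lemma dbar_eq0 x X : sphere x -> tangent x X ->
  (forall Y, tangent x Y ->
    (toC Y + 'i%C *: toC (Y *m J x)) *m dbar J P x X = 0) ->
  dbar J P x X = 0.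
Proof.
move=> Sx Xx h; have PP := Pperp_idem J x; have Ph := Pperp_adj J x.
have tD : grass_tangent (P x) (dbar J P x X).
  apply: grass_tangentB; first exact: dPperp_tangent Sx (tangent_actJ acJ Sx Xx).
  exact: grassK_tangent PP Ph (dPperp_tangent Sx Xx).
have QD : oblique_proj J x *m dbar J P x X = 0.
  rewrite /oblique_proj mulmxDl toCM -mulmxA dbar_normal// mulmx0 add0r -scalemxAl.
  rewrite [X in _ *: X](_ : _ = 0) ?scaler0//.
  apply/row_matrixP => i; rewrite row0 row_mul.
  have ti : tangent x (row i (tangent_proj x)).
    rewrite /tangent/= dotvC /dotv -row_mul tangent_proj_tangent//.
    by rewrite row0 mxE.
  rewrite row_mul mulmxDr mulmx1 -scalemxAr -toC_row -toCM.
  exact: h.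
apply: (grass_tangent_eq0 Ph tD).
by rewrite -(Pperp_oblique J Sx) -mulmxA QD mulmx0.
Qed.

Lemma tangent_algebra_tangent V W x : vfield V -> vfield W -> sphere x ->
  tangent x (tangent_algebra nabla J V W x).
Proof.
move=> fV fW Sx; rewrite /tangent/= /tangent_algebra dotvBr.
rewrite (_ : dotv x (covJ _ _ (actJ J V) _ x) = 0); last first.
  exact: (tangent_covJ (vfield_actJ fV) fW Sx).
rewrite (_ : dotv x _ = 0) ?subrr//.
exact: (tangent_actJ acJ Sx (tangent_covJ fV fW Sx)).
Qed.

Lemma tangent_algebra_eq0 V W x : vfield V -> vfield W -> sphere x ->
  dbar J P x (V x) = 0 -> tangent_algebra nabla J V W x = 0.
Proof.
move=> fV fW Sx D0; have tm := tangent_algebra_tangent fV fW Sx.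
have := dbar_T01 fV fW Sx; rewrite D0 mulmx0 mulmxBr mulmx1 => /esym/eqP.
rewrite subr_eq0 => /eqP/esym/(Pperp_real_tangent Sx (tangent_actJ acJ Sx tm)) mJ.
by apply: oppr_inj; rewrite -(acs_square acJ Sx tm) mJ mul0mx oppr0.
Qed.

End InducedProjectionDerivative.

Theorem theorem5p3 (R : realType) (n : nat)
    (J : 'rV[R]_(2 * n + 1) -> 'M[R]_(2 * n + 1))
    (nabla : ('rV[R]_(2 * n + 1) -> 'rV[R]_(2 * n + 1)) ->
             ('rV[R]_(2 * n + 1) -> 'rV[R]_(2 * n + 1)) ->
             'rV[R]_(2 * n + 1) -> 'rV[R]_(2 * n + 1))
    (hn : n = 1%N \/ n = 3%N)
    (hJ : almost_complex J) (hnabla : levi_civita nabla) :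
  (forall x X Y : 'rV[R]_(2 * n + 1), sphere x -> tangent x X -> tangent x Y ->
     toC (outward_normal x) *m dbar J (Pperp J) x X = 0 /\
     (forall V W : 'rV[R]_(2 * n + 1) -> 'rV[R]_(2 * n + 1),
        vfield V -> vfield W -> V x = X -> W x = Y ->
        (toC Y + 'i%C *: toC (Y *m J x)) *m dbar J (Pperp J) x X =
        toC (tangent_algebra nabla J V W x *m J x) *m (1%:M - Pperp J x))) /\
  ((forall x X : 'rV[R]_(2 * n + 1), sphere x -> tangent x X ->
      dbar J (Pperp J) x X = 0) <-> strongly_integrable nabla J) /\
  (strongly_integrable nabla J <->
   (forall V W : 'rV[R]_(2 * n + 1) -> 'rV[R]_(2 * n + 1),
      vfield V -> vfield W ->
      forall x : 'rV[R]_(2 * n + 1), sphere x -> tangent_algebra nabla J V W x = 0)).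
Proof.
have integrableE : strongly_integrable nabla J <->
    (forall V W, vfield V -> vfield W ->
      forall x, sphere x -> tangent_algebra nabla J V W x = 0).
  split=> H V W fV fW x Sx; first by rewrite /tangent_algebra H// subrr.
  by apply/eqP; rewrite -subr_eq0; apply/eqP; exact: H.
split; [|split=> //].
  move=> x X Y Sx Xx Yx; split; first exact: dbar_normal.
  by move=> V W fV fW <- <-; exact: dbar_T01.
rewrite integrableE; split=> [D0 V W fV fW x Sx|m0 x X Sx Xx].
  by apply: tangent_algebra_eq0 => //; apply: D0 => //; exact: fV.2.
apply: dbar_eq0 => // Y Yx.
have fX := vfield_tangent_extension X; have fY := vfield_tangent_extension Y.
have := dbar_T01 hJ hnabla fX fY Sx.
rewrite (m0 _ _ fX fY x Sx) (tangent_extensionE Xx) (tangent_extensionE Yx) => ->.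
by rewrite mul0mx toC0 mul0mx.
Qed.
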